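(* Let $T$ be a rooted tree with $n$ leaves and write $$\Gamma_T(x)=\det(xI-C(T))=\sum_{k=0}^n(-1)^k\gamma_k(T)x^{n-k}.$$ Then for each $k\in\{0,1,\ldots,n\}$, $\gamma_k(T)$ equals the number of edge-disjoint collections of upward paths of $T$ in which exactly $k$ of the paths are non-trivial. Consequently, $$\det(I+C(T))=(-1)^n\Gamma_T(-1)=\sum_{k=0}^n\gamma_k(T)$$ is the total number of edge-disjoint collections of upward paths of $T$.
   Context: A rooted tree $T$ has a distinguished vertex $r$, the root; the level $\ell(v)$ of a vertex $v$ is its distance from $r$. A leaf is a vertex without children (the root counts as a leaf only if it is the only vertex). For vertices $v,w$, $v\vee w$ denotes the common ancestor of $v$ and $w$ farthest from the root (every vertex is an ancestor of itself). If $v_1,\ldots,v_n$ are the leaves, the ancestral matrix $C(T)$ is the $n\times n$ matrix with $(i,j)$ entry $\ell(v_i\vee v_j)$. An upward path from a leaf is a path starting at that leaf and moving only towards the root; it may be trivial (consisting of the leaf alone, with no edges). A collection of upward paths consists of one upward path starting at each leaf of $T$; it is edge-disjoint if no two of its paths share an edge (they may share vertices). *)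

(* Defs.v *)
From HB Require Import structures.
From mathcomp Require Import all_boot all_order all_algebra.

Set Implicit Arguments.
Unset Strict Implicit.
Unset Printing Implicit Defensive.

Import Order.TTheory GRing.Theory Num.Theory.
Local Open Scope ring_scope.

(* [ucycle] asks for pairwise distinct vertices; a cycle of size at most 2 is  *)
(* empty, a loop, or a single edge traversed back and forth.                   *)
Record rooted_tree := RootedTree {
  vertex :> finType;
  edge : rel vertex;
  root : vertex;
  edge_sym : symmetric edge;
  edge_irr : irreflexive edge;
  edge_connected : forall x y, connect edge x y;
  edge_acyclic : forall c : seq vertex, ucycle edge c -> (size c <= 2)%N
}.

Arguments root {T} : rename.
Arguments edge {T} : rename.

Section RootedTree.
Variable T : rooted_tree.
Implicit Types u v w : T.

(* Distance from the root: the least number of edges of a walk from the root   *)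
(* to v. Since T is connected, it is always smaller than #|T|.                 *)
Definition level v : nat :=
  find (fun k => [exists p : k.-tuple T, path edge root p && (last root p == v)])
       (iota 0 #|T|).

(* w is the parent of v, i.e. the edge vw leads from v towards the root. *)
Definition parent v w : bool := edge v w && (level w < level v)%N.

Definition ancestor w v : bool := connect parent v w.

Definition is_leaf v : bool := [forall w, ~~ parent w v].

(* The root is a common ancestor of any two vertices, so that the maximum is   *)
(* taken over a non-empty set.                                                 *)
Definition join v w : T :=
  [arg max_(u > root | ancestor u v && ancestor u w) level u].

Definition ancestral_matrix n (v : n.-tuple T) : 'M[int]_n :=
  \matrix_(i, j) (level (join (tnth v i) (tnth v j)))%:Z.

(* An upward path from the leaf v is v :: p with [upward_path v p]. *)
Definition upward_path v (p : seq T) : bool := path parent v p.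

Definition path_edges v (p : seq T) : seq {set T} :=
  pairmap (fun x y => [set x; y]) v p.

Definition leaf_of : finType := {v : T | is_leaf v}.

(* c l lists the vertices after the leaf l on the path starting at l. Levels   *)
(* strictly decrease along upward paths, so the bound #|T| on the length of    *)
(* these lists excludes none of them.                                          *)
Definition path_family : finType := {ffun leaf_of -> #|T|.-bseq T}.

Definition edge_disjoint (c : path_family) : bool :=
  [forall l1, forall l2, (l1 != l2) ==>
    ~~ has (mem (path_edges (val l1) (c l1))) (path_edges (val l2) (c l2))].

Definition edge_disjoint_collections : {set path_family} :=
  [set c : path_family |
    [forall l, upward_path (val l) (c l)] && edge_disjoint c].

Definition nontrivial_paths (c : path_family) : {set leaf_of} :=
  [set l | c l != [::] :> seq T].

End RootedTree.

(* The coefficients in char_poly C = \sum_k (-1)^k gamma_k 'X^(n - k); only    *)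
(* meaningful for k <= n.                                                      *)
Definition gamma n (C : 'M[int]_n) (k : nat) : int :=
  (-1) ^+ k * (char_poly C)`_(n - k).

(* Main.v *)
(* The (i, j) entry of C(T) is the number of edges common to the paths from    *)
(* leaves i and j to the root, so row i of aI + bC(T) is a e_i plus b times    *)
(* the sum, over the edges e above leaf i, of the indicator of the leaves      *)
(* below e. By multilinearity det(aI + bC(T)) is a sum over all choices f of   *)
(* one upward path per leaf, encoded by its last edge, of a weight times a     *)
(* 0/1 determinant. If two chosen paths share an edge, exchanging their tails  *)
(* swaps two rows of that determinant, so such choices cancel in pairs. If the *)
(* paths are edge-disjoint, the 0/1 matrix is unitriangular up to a            *)
(* simultaneous reordering of rows and columns and the determinant is 1. The   *)
(* theorem is the case a = X, b = -1.                                          *)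
Require Import Defs.
From HB Require Import structures.
From mathcomp Require Import all_boot all_order all_algebra.
From mathcomp Require Import fingroup perm.

Set Implicit Arguments.
Unset Strict Implicit.
Unset Printing Implicit Defensive.

Import Order.TTheory GRing.Theory Num.Theory.
Local Open Scope ring_scope.

(** * Determinants counting common edges *)

Section CommonEdgesDeterminant.

(** The cancellation only needs that the edges above a leaf form a chain closed towards the root, so
    it is carried out for abstract [on] and [below], where [below e e'] means that [e'] is reached
    from [e] by going up (possibly [e' = e]). The involution [swap_tails] and [det_choice_mx] give
    [det_common_edges]. The tree enters through [parent_unique], which makes upward paths rigid,
    [level_join], which makes the matrix entries counts of common edges, and [sum_collections],
    which matches conflict-free choices with edge-disjoint collections. *)

Variables (n : nat) (E : finType) (on : 'I_n -> pred E) (below : rel E).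
Hypothesis below_trans : transitive below.
Hypothesis on_refl : forall i e, on i e -> below e e.
Hypothesis on_up : forall i e e', on i e -> below e e' -> on i e'.
Hypothesis on_total :
  forall i e e', on i e -> on i e' -> below e e' || below e' e.

Implicit Types (f : {ffun 'I_n -> option E}) (i j : 'I_n) (e : E).

Definition valid f := [forall i, oapp (on i) true (f i)].

(* A path is given by its last edge, [None] for a trivial path; [users f e] are *)
(* the paths through [e].                                                      *)
Definition users f e := [set i | on i e && oapp (below e) false (f i)].

Definition conflicting f := [exists e, (1 < #|users f e|)%N].

Definition precomp f (s : 'S_n) : {ffun 'I_n -> option E} :=
  [ffun i => f (s i)].

(** Both tails reach at least up to [e], hence past [e']; whether [i] or [j] uses [e'] then depends
    on the leaf alone, not on its tail. *)
Lemma users_swap_below f e e' i j : i \in users f e -> j \in users f e ->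
  below e' e -> users (precomp f (tperm i j)) e' = users f e'.
Proof.
rewrite !inE => /andP[ie fi] /andP[je fj] e'e; apply/setP => k; rewrite !inE ffunE.
have up g : oapp (below e) false g -> oapp (below e') false g.
  by case: g => //= u; apply: below_trans.
by case: tpermP => // ->; rewrite !up.
Qed.

(** An edge not below [e] lies above leaf [i] exactly when it lies above [e], and likewise for [j];
    so there the swap just exchanges [i] and [j] among the users. *)
Lemma card_users_swap f e e' i j : i \in users f e -> j \in users f e ->
  #|users (precomp f (tperm i j)) e'| = #|users f e'|.
Proof.
move=> iU jU; have [e'e|Ne'e] := boolP (below e' e).
  by rewrite (users_swap_below iU jU e'e).
have onE k : k \in users f e -> on k e' = below e e'.
  rewrite inE => /andP[ke _]; apply/idP/idP => [ke'|]; last exact: on_up ke.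
  by have := on_total ke ke'; rewrite (negPf Ne'e) orbF.
rewrite -(card_preimset (users f e') (@perm_inj _ (tperm i j))).
apply: eq_card => k; rewrite !inE ffunE; congr andb.
by case: tpermP => // ->; rewrite !onE.
Qed.

Lemma valid_swap f e i j : i \in users f e -> j \in users f e ->
  valid f -> valid (precomp f (tperm i j)).
Proof.
rewrite !inE => /andP[ie fi] /andP[je fj] /forallP vf; apply/forallP => k.
rewrite ffunE; case: tpermP => [->|->|_ _]; last exact: vf.
- by case: (f j) fj => //= u; apply: on_up.
- by case: (f i) fi => //= u; apply: on_up.
Qed.

(** The edge is picked from the numbers of users only, and the pair from the set of users of that
    edge only. Swapping preserves both data, so a second swap undoes the first. *)
Definition conflict_edge f := [pick e | (1 < #|users f e|)%N].

Definition conflict_pair (U : {set 'I_n}) :=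
  [pick p : 'I_n * 'I_n | [&& p.1 \in U, p.2 \in U & p.1 != p.2]].

Definition swap_tails f :=
  if conflict_edge f is Some e then
    if conflict_pair (users f e) is Some p then precomp f (tperm p.1 p.2) else f
  else f.

Lemma swap_tailsP f : conflicting f -> exists e i j,
  [/\ conflict_edge f = Some e, conflict_pair (users f e) = Some (i, j),
      [/\ i \in users f e, j \in users f e & i != j]
    & swap_tails f = precomp f (tperm i j)].
Proof.
case/existsP=> e0 e0P; rewrite /swap_tails.
case ce: (conflict_edge f) => [e|]; last first.
  by move: ce; rewrite /conflict_edge; case: pickP => // /(_ e0); rewrite e0P.
have eU : (1 < #|users f e|)%N.
  by move: ce; rewrite /conflict_edge; case: pickP => // e1 e1P [<-].
case cp: (conflict_pair (users f e)) => [[i j]|].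
  exists e, i, j; split=> //; move: cp; rewrite /conflict_pair.
  by case: pickP => // p /and3P[iU jU ij] [pE]; move: iU jU ij; rewrite pE.
have /card_gt1P[i [j [iU jU ij]]] := eU.
move: cp; rewrite /conflict_pair; case: pickP => // /(_ (i, j)).
by rewrite /= iU jU ij.
Qed.

Lemma conflict_edge_swap f e i j : i \in users f e -> j \in users f e ->
  conflict_edge (precomp f (tperm i j)) = conflict_edge f.
Proof.
by move=> iU jU; apply: eq_pick => e'; rewrite (card_users_swap e' iU jU).
Qed.

Lemma swap_tailsK f : conflicting f -> swap_tails (swap_tails f) = f.
Proof.
move=> /swap_tailsP[e [i [j [ce cp [iU jU ij] ->]]]].
rewrite /swap_tails (conflict_edge_swap iU jU) ce.
have ee : below e e by move: iU; rewrite inE => /andP[/on_refl].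
rewrite (users_swap_below iU jU ee) cp /=.
by apply/ffunP => k; rewrite !ffunE tpermK.
Qed.

Lemma conflicting_swap f : conflicting f -> conflicting (swap_tails f).
Proof.
move=> cf; have [e [i [j [_ _ [iU jU _] ->]]]] := swap_tailsP cf.
have /existsP[e' e'P] := cf; apply/existsP; exists e'.
by rewrite (card_users_swap e' iU jU).
Qed.

Lemma valid_swap_tails f : conflicting f -> valid f -> valid (swap_tails f).
Proof.
by move=> /swap_tailsP[e [i [j [_ _ [iU jU _] ->]]]]; apply: valid_swap iU jU.
Qed.

Variable R : idomainType.

Definition choice_mx f : 'M[R]_n :=
  \matrix_(i, j) oapp (fun e => (on j e)%:R) (i == j)%:R (f i).

Definition weight (a b : R) f := \prod_i (if f i is Some _ then b else a).

(** The two swapped paths are non-trivial, so their rows depend on the last edges only and the swap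
    transposes them. The row of a trivial path, by contrast, depends on its index. *)
Lemma det_choice_mx_swap f : conflicting f ->
  \det (choice_mx (swap_tails f)) = - \det (choice_mx f).
Proof.
move=> /swap_tailsP[e [i [j [_ _ [iU jU ij] ->]]]].
have -> : choice_mx (precomp f (tperm i j)) = row_perm (tperm i j) (choice_mx f).
  apply/matrixP => k l; rewrite !mxE ffunE.
  case: tpermP => // ->.
    by move: jU; rewrite inE; case: (f j) => [u|]; rewrite ?andbF.
  by move: iU; rewrite inE; case: (f i) => [u|]; rewrite ?andbF.
by rewrite row_permE det_mulmx det_perm odd_tperm ij expr1 mulN1r.
Qed.

Lemma weight_swap a b f : conflicting f ->
  weight a b (swap_tails f) = weight a b f.
Proof.
move=> /swap_tailsP[e [i [j [_ _ _ ->]]]]; rewrite /weight.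
rewrite [RHS](reindex_inj (@perm_inj _ (tperm i j))).
by apply: eq_bigr => k _; rewrite ffunE.
Qed.

(* If no two paths share an edge and [on (s i) e] with [e] the last edge of    *)
(* path [i], then the last edge of path [s i] is strictly below [e]; summing   *)
(* heights over all [i] shows that only the identity contributes.              *)
Lemma det_choice_mx f : valid f -> ~~ conflicting f -> \det (choice_mx f) = 1.
Proof.
move=> /forallP vf ncf; rewrite /determinant (bigD1 1%g) //= odd_perm1 mul1r.
rewrite big1 ?mul1r => [|i _]; last first.
  rewrite !mxE perm1; have := vf i; case: (f i) => [e|] /=; last by rewrite eqxx.
  by move=> ->.
rewrite big1 ?addr0 // => s s1; apply/eqP; rewrite mulf_eq0; apply/orP; right.
apply/negPn/negP => /prodf_neq0 nz.
pose height o : nat := oapp (fun e => #|[set e' | below e e']|) 0%N o.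
have b01 (c : bool) : (c%:R != 0 :> R) = c by case: c; rewrite ?oner_eq0 ?eqxx.
have step i : s i != i -> (height (f i) < height (f (s i)))%N.
  move=> si; have := nz i isT; have := nz (s i) isT; rewrite !mxE.
  have := vf i; have := vf (s i).
  case fi: (f i) => [u|]; case fsi: (f (s i)) => [u'|] /=; rewrite ?b01.
  - move=> siu' iu _ siu.
    (* Leaf [s i] lies below [u]; if [u] were below [u'], both paths would traverse [u]. *)
    have Nuu' : ~~ below u u'.
      apply: contra ncf => uu'; apply/existsP; exists u; apply/card_gt1P.
      exists i, (s i); split; rewrite ?inE ?fi ?fsi /= 1?eq_sym //.
      - by rewrite iu (on_refl iu).
      - by rewrite siu uu'.
    have u'u : below u' u by have := on_total siu siu'; rewrite (negPf Nuu').
    apply/proper_card/properP; split.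
      by apply/subsetP => w; rewrite !inE; apply: below_trans.
    by exists u'; rewrite !inE ?(on_refl siu') ?Nuu'.
  (* Path [s i] is trivial, so its nonzero entry forces [s (s i) = s i]. *)
  - by move=> _ _ /eqP/perm_inj; move: si => /[swap] <-; rewrite eqxx.
  - by move=> _ _ _; rewrite eq_sym (negPf si).
  - by move=> _ _ _; rewrite eq_sym (negPf si).
have /existsP[i si] : [exists i, s i != i].
  apply: contraNT s1 => /existsPn s1; apply/eqP/permP => i; rewrite perm1.
  by apply/eqP/negPn.
have : (\sum_i height (f i) < \sum_i height (f (s i)))%N.
  rewrite (bigD1 i) //= [ltnRHS](bigD1 i) //= -addSn leq_add ?step //.
  apply: leq_sum => k _.
  by have [->|/step/ltnW] := eqVneq (s k) k.
by rewrite [ltnLHS](reindex_inj (@perm_inj _ s)) ltnn.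
Qed.

Definition common_edges i j := #|[set e | on i e && on j e]|.

Theorem det_common_edges (a b : R) : 2%:R != 0 :> R ->
  \det (a%:M + b *: \matrix_(i, j) (common_edges i j)%:R) =
  \sum_(f | valid f && ~~ conflicting f) weight a b f.
Proof.
move=> two; transitivity (\sum_(f | valid f) weight a b f * \det (choice_mx f)).
  transitivity (\sum_(s : 'S_n) \sum_(f | valid f)
      (-1) ^+ s * (weight a b f * \prod_i choice_mx f i (s i))); last first.
    rewrite exchange_big; apply: eq_bigr => f _; rewrite /determinant mulr_sumr.
    by apply: eq_bigr => s _; rewrite mulrCA.
  apply: eq_bigr => s _; rewrite -mulr_sumr; congr (_ * _).
  (* Putting the validity test into each factor lets [o] range over all of [option E], so that the
     product of sums can be distributed. *)
  pose G i (o : option E) : R := (oapp (on i) true o)%:R *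
    ((if o is Some _ then b else a) *
     oapp (fun e => (on (s i) e)%:R) (i == s i)%:R o).
  transitivity (\prod_i \sum_o G i o).
    apply: eq_bigr => i _; rewrite !mxE /G.
    rewrite (bigD1 None) //= mul1r; congr (_ + _); first by rewrite mulr_natr.
    rewrite (reindex_omap Some id) /=; last by case.
    rewrite /common_edges -sum1_card natr_sum mulr_sumr.
    rewrite [LHS]big_mkcond; apply: eq_big => [e|e _]; first by rewrite eqxx.
    rewrite inE; case: (on i e) => /=; rewrite ?mul0r // mul1r.
    by case: (on _ _); rewrite ?mulr0.
  rewrite bigA_distr_bigA /= [RHS]big_mkcond /=; apply: eq_bigr => f _.
  case: ifPn => [/forallP vf|/forallPn[i]]; last first.
    by move=> Nvf; rewrite (bigD1 i) //= /G (negPf Nvf) !mul0r.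
  rewrite -big_split /=; apply: eq_bigr => i _.
  by rewrite /G vf mul1r mxE.
rewrite (bigID conflicting) /= [X in X + _](_ : _ = 0) ?add0r.
  by apply: eq_bigr => f /andP[vf ncf]; rewrite det_choice_mx ?mulr1.
(* Reindexing by [swap_tails] keeps each weight and negates each determinant; [two] then kills the
   conflicting part. *)
set S := \sum_(_ | _) _; have : S = - S.
  rewrite {1}/S (reindex_onto swap_tails swap_tails) => [|f /andP[_ /swap_tailsK]//].
  rewrite -sumrN; apply: eq_big => [f|f].
    apply/idP/idP => [/andP[/andP[vf cf]] /eqP fE|/andP[vf cf]].
      by rewrite -fE; apply/andP; split;
        [exact: valid_swap_tails cf vf|exact: conflicting_swap cf].
    by rewrite valid_swap_tails ?conflicting_swap ?swap_tailsK ?eqxx.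
  move=> /andP[/andP[vf cf]] /eqP fE.
  have cf' : conflicting f by rewrite -fE; apply: conflicting_swap cf.
  by rewrite weight_swap ?det_choice_mx_swap ?mulrN.
move/eqP; rewrite -subr_eq0 opprK -mulr2n -mulr_natr mulf_eq0 (negPf two) orbF.
by move/eqP.
Qed.

End CommonEdgesDeterminant.

(** * Levels, parents and ancestors *)

Section TreeTheory.

Local Open Scope nat_scope.
Local Notation root := Defs.root.

Variable T : rooted_tree.
Implicit Types u v w x y : T.

Definition walk (k : nat) v :=
  [exists p : k.-tuple T, path edge root p && (last root p == v)].

Lemma walkP k v :
  reflect (exists p, [/\ path edge root p, last root p = v & size p = k]) (walk k v).
Proof.
apply: (iffP existsP) => [[p /andP[pp /eqP pv]]|[p [pp pv /eqP pk]]].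
  by exists p; rewrite size_tuple.
by exists (Tuple pk); rewrite pp /= pv eqxx.
Qed.

(** A walk without repeated vertices has fewer than [#|T|] edges, so the bounded search in [level]
    succeeds. *)
Lemma has_walk v : has (walk ^~ v) (iota 0 #|T|).
Proof.
have /connectP[p pp ->] := edge_connected root v.
case/shortenP: pp => q qp q_uniq _; apply/hasP; exists (size q).
  by rewrite mem_iota; have := max_card [in root :: q]; rewrite (card_uniqP q_uniq).
by apply/walkP; exists q.
Qed.

Lemma walk_level v : walk (level v) v.
Proof.
have := nth_find 0 (has_walk v); rewrite nth_iota //.
by rewrite -[X in _ < X](size_iota 0) -has_find has_walk.
Qed.

Lemma level_le_walk k v : walk k v -> level v <= k.
Proof.
move=> kv; rewrite leqNgt; apply/negP => klt.
have := before_find 0 klt; rewrite nth_iota; first by rewrite -/(walk _ v) kv.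
by apply: leq_trans klt _; rewrite -[X in _ <= X](size_iota 0) find_size.
Qed.

Lemma level_root : level (root : T) = 0.
Proof.
by apply/eqP; rewrite -leqn0 level_le_walk //; apply/walkP; exists [::].
Qed.

Lemma level_edge v w : edge v w -> level w <= (level v).+1.
Proof.
move=> vw; have /walkP[p [pp pv pk]] := walk_level v.
apply: level_le_walk; apply/walkP; exists (rcons p w).
by rewrite rcons_path pp pv last_rcons size_rcons pk.
Qed.

Lemma parent_level v w : parent v w -> level v = (level w).+1.
Proof.
case/andP; rewrite edge_sym => /level_edge le lt; apply/eqP.
by rewrite eqn_leq le lt.
Qed.

Lemma parent_exists v : v != root -> exists w, parent v w.
Proof.
move=> vr; have /walkP[p [pp pv pk]] := walk_level v.
elim/last_ind: p pp pv pk => [|p x _] => [_ /= rv|].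
  by rewrite -rv eqxx in vr.
rewrite rcons_path last_rcons size_rcons => /andP[pp ex] xv pk.
exists (last root p); rewrite /parent edge_sym -xv ex /= xv -pk ltnS.
by apply: level_le_walk; apply/walkP; exists p.
Qed.

Lemma parent_root w : parent (root : T) w = false.
Proof. by rewrite /parent level_root andbF. Qed.

(* Two distinct parents of [v] are connected through the root by a walk of     *)
(* vertices of smaller level, which closes to a cycle through [v].             *)
Lemma parent_unique v w w' : parent v w -> parent v w' -> w = w'.
Proof.
move=> vw vw'; apply/eqP/negPn/negP => ww'.
pose e := [rel x y : T | [&& edge x y, x != v & y != v]].
have e_sym : symmetric e by move=> x y /=; rewrite edge_sym [(x != v) && _]andbC.
have con x : level x < level v -> connect e root x.
  have [k] := ubnP (level x); elim: k x => // k IH x; rewrite ltnS => xk xv.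
  have [->|xr] := eqVneq x root; first exact: connect0.
  have [y xy] := parent_exists xr; have yx := parent_level xy.
  have yv : level y < level v by apply: leq_ltn_trans xv; rewrite yx.
  have yk : level y < k by rewrite -yx.
  apply: connect_trans (IH y yk yv) (connect1 _) => /=.
  have /andP[exy _] := xy; rewrite edge_sym exy /=.
  by apply/andP; split; [apply: contraTneq yv|apply: contraTneq xv] => ->;
    rewrite ltnn.
have : connect e w w'.
  have /andP[_ lw] := vw; have /andP[_ lw'] := vw'.
  apply: connect_trans (con w' lw'); rewrite (sym_connect_sym e_sym); exact: con.
case/connectP => p /shortenP[q eq uq _] w'E.
have qp : path edge w q by apply: sub_path eq => x y /and3P[].
have vq : v \notin w :: q.
  rewrite inE negb_or; apply/andP; split.
    have /andP[_ lw] := vw.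
    by apply: contraTneq lw => ->; rewrite ltnn.
  case: (q) eq => //= x s /andP[/and3P[_ _ xv] ps].
  rewrite inE negb_or eq_sym xv /=.
  elim: s x {xv} ps => //= y s IH x /andP[/and3P[_ _ yv] ps].
  by rewrite inE negb_or eq_sym yv (IH y).
have cyc : ucycle edge (v :: w :: q).
  apply/andP; split; last by rewrite cons_uniq vq.
  rewrite /= rcons_path qp -w'E [edge w' v]edge_sym.
  by have /andP[-> _] := vw'; have /andP[-> _] := vw.
(* Size at most 2 leaves [q] empty, that is, [w' = w]. *)
have := edge_acyclic cyc.
by case: (q) w'E => //= w'E; rewrite w'E eqxx in ww'.
Qed.

(** The default makes the root its own [par], in step with truncated subtraction on levels. *)
Definition par v : T := odflt v [pick w | parent v w].

Lemma parentE v w : parent v w = (v != root) && (w == par v).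
Proof.
have [->|vr] := eqVneq v root; first by rewrite parent_root.
have [x vx] := parent_exists vr.
have vp : parent v (par v) by rewrite /par; case: pickP => //= /(_ x); rewrite vx.
by apply/idP/eqP => [vw|->//]; apply: parent_unique vw vp.
Qed.

Lemma par_root : par root = root.
Proof. by rewrite /par; case: pickP => //= x; rewrite parent_root. Qed.

Lemma level_eq0 v : (level v == 0) = (v == root).
Proof.
apply/idP/eqP => [v0|->]; last by rewrite level_root.
apply/eqP/negPn/negP => /parent_exists[w /parent_level vw].
by rewrite vw in v0.
Qed.

Lemma level_par v : level (par v) = (level v).-1.
Proof.
have [->|vr] := eqVneq v root; first by rewrite par_root level_root.
by rewrite [level v](@parent_level v (par v)) // parentE vr /=.
Qed.

Lemma level_par_lt v : v != root -> level v = (level (par v)).+1.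
Proof. by rewrite -level_eq0 level_par; case: level. Qed.

Lemma level_iter_par k v : level (iter k par v) = level v - k.
Proof. by elim: k => [|k IH]; rewrite ?subn0 //= level_par IH subnS. Qed.

Lemma ancestor_refl v : ancestor v v.
Proof. exact: connect0. Qed.

Lemma ancestor_trans v u w : ancestor u v -> ancestor v w -> ancestor u w.
Proof. by move=> uv vw; apply: connect_trans vw uv. Qed.

Lemma ancestor_par v : ancestor (par v) v.
Proof.
have [->|vr] := eqVneq v root; first by rewrite par_root ancestor_refl.
by apply: connect1; rewrite parentE vr eqxx.
Qed.

Lemma ancestor_iter k v : ancestor (iter k par v) v.
Proof.
elim: k => [|k IH]; first exact: ancestor_refl.
exact: ancestor_trans (ancestor_par _) IH.
Qed.

Lemma ancestorP u v :
  reflect (exists2 k, k <= level v & u = iter k par v) (ancestor u v).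
Proof.
apply: (iffP idP) => [/connectP[p]|[k _ ->]]; last exact: ancestor_iter.
elim: p v => [|w p IH] v /=; first by move=> _ ->; exists 0.
rewrite parentE => /andP[/andP[vr /eqP ->] pp] uE.
have [k kl ->] := IH _ pp uE; exists k.+1; last by rewrite iterSr.
by rewrite level_par_lt.
Qed.

Lemma ancestor_rec u v :
  ancestor u v = (u == v) || (v != root) && ancestor u (par v).
Proof.
apply/idP/idP => [|/orP[/eqP ->|/andP[_ uv]]]; last 1 first.
- exact: ancestor_trans uv (ancestor_par v).
- case/ancestorP => -[|k] kl ->; rewrite ?eqxx //.
  by rewrite -level_eq0 -lt0n (leq_trans _ kl) //= -iterS iterSr ancestor_iter orbT.
- exact: ancestor_refl.
Qed.

Lemma root_ancestor v : ancestor root v.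
Proof.
apply/ancestorP; exists (level v) => //; apply/esym/eqP.
by rewrite -level_eq0 level_iter_par subnn.
Qed.

Lemma ancestor_level u v : ancestor u v -> level u <= level v.
Proof. by case/ancestorP=> k _ ->; rewrite level_iter_par leq_subr. Qed.

Lemma ancestor_level_eq u v : ancestor u v -> level v <= level u -> u = v.
Proof.
case/ancestorP => -[|k] // kl ->; rewrite level_iter_par => vk.
suff: level v - k.+1 < level v by rewrite ltnNge vk.
by rewrite -subSn // subSS leq_subr.
Qed.

Lemma ancestor_total u w v : ancestor u v -> ancestor w v ->
  ancestor u w || ancestor w u.
Proof.
case/ancestorP => i _ -> /ancestorP[j _ ->].
have [ij|/ltnW ji] := leqP i j.
  by rewrite -(subnK ij) iterD ancestor_iter orbT.
by rewrite -(subnK ji) iterD ancestor_iter.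
Qed.

Lemma card_ancestors v : #|[set u | (u != root) && ancestor u v]| = level v.
Proof.
elim: {v}(level v) {-2}v (erefl (level v)) => [|k IH] v vk.
  have /eqP -> : v == root by rewrite -level_eq0 vk.
  rewrite level_root; apply/eqP; rewrite cards_eq0; apply/eqP/setP => u.
  by rewrite !inE ancestor_rec eqxx orbF andNb.
have vr : v != root by rewrite -level_eq0 vk.
have pk : level (par v) = k by rewrite level_par vk.
rewrite level_par_lt // -(IH _ pk).
have -> : [set u | (u != root) && ancestor u v] =
          v |: [set u | (u != root) && ancestor u (par v)].
  apply/setP => u; rewrite !inE [ancestor u v]ancestor_rec vr /= andb_orr.
  by have [->|] := eqVneq u v; rewrite ?vr ?andbF.
rewrite cardsU1 inE vr (_ : ancestor v (par v) = false) //.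
by apply/negP => /ancestor_level; rewrite (level_par_lt vr) ltnn.
Qed.

(** The common ancestors form a chain, so they are exactly the ancestors of the deepest one. *)
Lemma level_join v w :
  level (join v w) = #|[set u | [&& u != root, ancestor u v & ancestor u w]]|.
Proof.
rewrite -card_ancestors /join; case: arg_maxnP; first by rewrite !root_ancestor.
move=> j /andP[jv jw] jmax; apply: eq_card => u; rewrite !inE; congr andb.
apply/idP/andP => [uj|[uv uw]]; first by split; apply: ancestor_trans uj _.
case/orP: (ancestor_total uv jv) => // ju.
by rewrite (ancestor_level_eq ju (jmax u _)) ?uv ?uw ?ancestor_refl.
Qed.

(** As parents are unique, only the length of an upward path can be chosen; hence its last edge can
    encode it. *)
Lemma upward_pathE v p :
  upward_path v p = (p == traject par (par v) (size p)) && (size p <= level v).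
Proof.
rewrite /upward_path; elim: p v => [|w p IH] v //=.
rewrite parentE IH eqseq_cons; have [->|vr] := eqVneq v root.
  by rewrite level_root andbF.
by rewrite (level_par_lt vr) ltnS; case: eqP => // ->.
Qed.

Lemma path_edgesE v p : upward_path v p ->
  path_edges v p = [seq [set x; par x] | x <- traject par v (size p)].
Proof.
rewrite /upward_path; elim: p v => [|w p IH] v //=.
by rewrite parentE => /andP[/andP[_ /eqP ->] /IH ->].
Qed.

(** Otherwise [x] and [y] would be each other's parents, and a level would exceed itself by 2. *)
Lemma parent_edge_inj x y : x != root -> y != root ->
  [set x; par x] = [set y; par y] -> x = y.
Proof.
move=> xr yr xy; have : x \in [set y; par y] by rewrite -xy set21.
have : y \in [set x; par x] by rewrite xy set21.
rewrite !inE => /orP[/eqP->//|/eqP yE] /orP[/eqP->//|/eqP xE].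
have := level_par_lt xr; rewrite -yE (level_par_lt yr) -xE => /eqP.
by rewrite -addn2 -[X in X == _]addn0 eqn_add2l.
Qed.

(** The trajectory lists the lower ends of the [k] edges of a path from [v]; its last entry stands
    for the last edge, whence [k.-1]. *)
Lemma mem_traject_par v k u : k <= level v ->
  (u \in traject par v k) =
  [&& u != root, ancestor u v, k != 0 & ancestor (iter k.-1 par v) u].
Proof.
move=> kv; apply/trajectP/and4P => [[i ik ->]|[ur /ancestorP[i iv ->] k0]].
  split; rewrite ?ancestor_iter -?lt0n ?(leq_trans _ ik) //.
    by rewrite -level_eq0 level_iter_par -lt0n subn_gt0 (leq_trans ik).
  have ik1 : i <= k.-1 by case: (k) ik.
  by rewrite -(subnK ik1) iterD ancestor_iter.
move/ancestor_level; rewrite !level_iter_par leq_sub2lE // => ik.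
by exists i => //; rewrite -(prednK (_ : 0 < k)) ?lt0n.
Qed.

End TreeTheory.

(** * Edge-disjoint collections *)

Section Collections.

Local Notation root := Defs.root.

Variables (T : rooted_tree) (n : nat) (v : n.-tuple T).
Hypothesis v_uniq : uniq v.
Hypothesis v_leaves : forall x : T, (x \in v) = is_leaf x.
Implicit Types (u w : T) (i j : 'I_n) (l : leaf_of T) (c : path_family T).
Implicit Types (f : {ffun 'I_n -> option T}).

(* The edge from a non-root vertex to its parent is represented by that vertex. *)
Definition on i u := (u != root) && ancestor u (tnth v i).

Definition below u w := (w != root) && ancestor w u.

Lemma below_trans : transitive below.
Proof.
move=> y x z /andP[_ xy] /andP[zr yz]; rewrite /below zr.
exact: ancestor_trans yz xy.
Qed.

Lemma on_refl i u : on i u -> below u u.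
Proof. by move=> /andP[ur _]; rewrite /below ur ancestor_refl. Qed.

Lemma on_up i u w : on i u -> below u w -> on i w.
Proof.
by move=> /andP[_ ui] /andP[wr wu]; rewrite /on wr (ancestor_trans wu ui).
Qed.

Lemma on_total i u w : on i u -> on i w -> below u w || below w u.
Proof.
move=> /andP[ur ui] /andP[wr wi]; rewrite /below ur wr /= orbC.
exact: ancestor_total ui wi.
Qed.

Lemma ancestral_matrixE i j : ancestral_matrix v i j = (common_edges on i j)%:Z.
Proof.
rewrite mxE level_join; congr (Posz _); apply: eq_card => u; rewrite !inE /on.
by case: (u != root).
Qed.

Lemma is_leaf_tnth i : is_leaf (tnth v i).
Proof. by rewrite -v_leaves mem_tnth. Qed.

Definition leaf i : leaf_of T := exist _ (tnth v i) (is_leaf_tnth i).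

Lemma leaf_index_proof l : (index (val l) v < n)%N.
Proof.
by rewrite -[X in (_ < X)%N](size_tuple v) index_mem v_leaves (valP l).
Qed.

Definition leaf_index l : 'I_n := Ordinal (leaf_index_proof l).

Lemma leaf_indexK : cancel leaf_index leaf.
Proof.
move=> l; apply: val_inj; rewrite /= (tnth_nth (val l)) nth_index //.
by rewrite v_leaves (valP l).
Qed.

Lemma leafK : cancel leaf leaf_index.
Proof.
move=> i; apply: val_inj => /=.
by rewrite (tnth_nth (tnth v i)) index_uniq // size_tuple.
Qed.

(** An edge is named by its lower end, so the last of [k.+1] edges is the vertex reached after [k]
    steps. *)
Definition last_edges c : {ffun 'I_n -> option T} :=
  [ffun i => if size (c (leaf i)) is k.+1 then Some (iter k (@par T) (tnth v i))
             else None].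

(* The number of edges of the upward path from [l] whose last edge is [o]. *)
Definition path_length l (o : option T) : nat :=
  if o is Some u then (level (val l) - level u).+1 else 0.

Definition paths_to f : path_family T :=
  [ffun l => insub_bseq #|T|
    (traject (@par T) (par (val l)) (path_length l (f (leaf_index l))))].

Lemma level_lt_card u : (level u < #|T|)%N.
Proof. by rewrite -[X in (_ < X)%N](size_iota 0) -has_find has_walk. Qed.

Lemma path_length_le f l : valid on f ->
  (path_length l (f (leaf_index l)) <= level (val l))%N.
Proof.
move=> /forallP/(_ (leaf_index l)); case: (f _) => //= u /andP[ur].
have -> : tnth v (leaf_index l) = val l by rewrite -[in RHS](leaf_indexK l).
move/ancestor_level => ul; rewrite -level_eq0 -lt0n in ur.
by rewrite ltn_subrL ur (leq_trans ur ul).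
Qed.

Lemma paths_toE f l : valid on f ->
  paths_to f l = traject (@par T) (par (val l)) (path_length l (f (leaf_index l)))
    :> seq T.
Proof.
(* For a valid choice the length is at most a level, hence below [#|T|], and [insub_bseq] does not
   fall back to its default. *)
move=> vf; rewrite ffunE /insub_bseq insubdK // unfold_in size_traject.
exact: leq_trans (path_length_le l vf) (ltnW (level_lt_card _)).
Qed.

Definition upward c := [forall l, upward_path (val l) (c l)].

Lemma upward_paths_to f : valid on f -> upward (paths_to f).
Proof.
move=> vf; apply/forallP => l; rewrite upward_pathE paths_toE // size_traject eqxx.
exact: path_length_le.
Qed.

Lemma paths_toK f : valid on f -> last_edges (paths_to f) = f.
Proof.
move=> vf; apply/ffunP => i; rewrite ffunE paths_toE // size_traject leafK /=.
have := forallP vf i; case: (f i) => //= u /andP[_ /ancestorP[k kl ->]].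
by rewrite level_iter_par subKn.
Qed.

Lemma upward_size c i : upward c -> (size (c (leaf i)) <= level (tnth v i))%N.
Proof. by move=> /forallP/(_ (leaf i)); rewrite upward_pathE => /andP[]. Qed.

Lemma valid_last_edges c : upward c -> valid on (last_edges c).
Proof.
move=> uc; apply/forallP => i; rewrite ffunE; have := upward_size i uc.
case: (size _) => //= k kl; rewrite /on ancestor_iter andbT.
by rewrite -level_eq0 level_iter_par -lt0n subn_gt0.
Qed.

Lemma last_edgesK c : upward c -> paths_to (last_edges c) = c.
Proof.
move=> uc; apply/ffunP => l; apply: val_inj => /=.
rewrite paths_toE ?valid_last_edges // ffunE leaf_indexK.
have -> : tnth v (leaf_index l) = val l by rewrite -[in RHS](leaf_indexK l).
have := forallP uc l; rewrite upward_pathE => /andP[/eqP cE cl].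
rewrite [RHS]cE; case: (size _) cl => //= k kl.
by rewrite level_iter_par subKn // ltnW.
Qed.

Lemma mem_users c i u : upward c ->
  (i \in users on below (last_edges c) u) =
  (u \in traject (@par T) (tnth v i) (size (c (leaf i)))).
Proof.
move=> uc; rewrite (mem_traject_par u (upward_size i uc)) inE ffunE.
have := upward_size i uc.
case: (size _) => [|k] ki /=; rewrite ?andbF // /on /below.
by rewrite -[iter k _ _ == _]level_eq0 level_iter_par -lt0n subn_gt0 ki -andbA.
Qed.

(** By [parent_edge_inj], sharing an edge as a two-element set amounts to sharing its lower end. *)
Lemma conflicting_last_edges c : upward c ->
  conflicting on below (last_edges c) = ~~ edge_disjoint c.
Proof.
move=> uc.
have nonroot i u : u \in traject (@par T) (tnth v i) (size (c (leaf i))) ->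
    u != root.
  by rewrite (mem_traject_par u (upward_size i uc)) => /and4P[].
have edgesE i : path_edges (val (leaf i)) (c (leaf i)) =
    [seq [set x; par x] | x <- traject (@par T) (tnth v i) (size (c (leaf i)))].
  by rewrite path_edgesE //; apply: (forallP uc).
apply/existsP/forallPn => [[u /card_gt1P[i [j [iu ju ij]]]]|[l1]].
  exists (leaf i); apply/forallPn; exists (leaf j).
  rewrite negb_imply negbK (can_eq leafK) ij; apply/hasP.
  exists [set u; par u]; rewrite /= edgesE; apply/mapP; exists u => //.
    by rewrite -mem_users.
  by rewrite -mem_users.
case/forallPn=> l2; rewrite negb_imply negbK -[l1]leaf_indexK -[l2]leaf_indexK.
case/andP=> ij /hasP[e]; rewrite /= !edgesE => /mapP[x xj ->] /mapP[y yi xy].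
move: (parent_edge_inj (nonroot _ _ xj) (nonroot _ _ yi) xy) => {xy} xy.
exists x; apply/card_gt1P; exists (leaf_index l1), (leaf_index l2).
rewrite !mem_users // xj xy yi; split=> //.
by apply: contraNneq ij => ->.
Qed.

Lemma sum_collections (R : nmodType) (F : {ffun 'I_n -> option T} -> R) :
  \sum_(f | valid on f && ~~ conflicting on below f) F f =
  \sum_(c in edge_disjoint_collections T) F (last_edges c).
Proof.
rewrite (reindex_onto last_edges paths_to) => [|f /andP[vf _]]; last exact: paths_toK.
apply: eq_bigl => c; rewrite inE -/(upward c); apply/idP/andP.
  case/andP=> /andP[vc ncc] /eqP cE.
  have uc : upward c by rewrite -cE upward_paths_to.
  by split=> //; rewrite -[edge_disjoint c]negbK -conflicting_last_edges.
case=> uc dc; rewrite valid_last_edges // last_edgesK // eqxx andbT /=.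
by rewrite conflicting_last_edges // negbK.
Qed.

Lemma card_leaf_of : #|leaf_of T| = n.
Proof. by rewrite -(bij_eq_card (Bijective leafK leaf_indexK)) card_ord. Qed.

Lemma nontrivial_paths_le c : (#|nontrivial_paths c| <= n)%N.
Proof. by rewrite -[X in (_ <= X)%N]card_leaf_of max_card. Qed.

Lemma weight_last_edges (R : idomainType) (a b : R) c :
  weight a b (last_edges c) =
  b ^+ #|nontrivial_paths c| * a ^+ (n - #|nontrivial_paths c|).
Proof.
rewrite /weight (reindex leaf_index) /=; last first.
  by exists leaf => ? _; rewrite ?leafK ?leaf_indexK.
rewrite (bigID [in nontrivial_paths c]) /=; congr (_ * _).
  rewrite (eq_bigr (fun=> b)) ?prodr_const // => l.
  by rewrite inE ffunE leaf_indexK -size_eq0; case: (size _).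
rewrite (eq_bigr (fun=> a)) => [|l].
  rewrite (eq_bigl [in ~: nontrivial_paths c]) => [|l]; last by rewrite /= in_setC.
  by rewrite prodr_const cardsCs setCK card_leaf_of.
by rewrite inE ffunE leaf_indexK -size_eq0 negbK => /eqP ->.
Qed.

Lemma char_poly_ancestral_matrix :
  char_poly (ancestral_matrix v) =
  \sum_(c in edge_disjoint_collections T)
    (-1) ^+ #|nontrivial_paths c| *: 'X^(n - #|nontrivial_paths c|).
Proof.
transitivity (\det ('X%:M + (-1 : {poly int}) *:
    \matrix_(i, j) (common_edges on i j)%:R)).
  congr (\det _); apply/matrixP => i j.
  rewrite !mxE mulN1r -polyC_natr natz; congr (_ - _%:P).
  by have := ancestral_matrixE i j; rewrite mxE.
rewrite (det_common_edges below_trans on_refl on_up on_total); last first.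
  by rewrite -polyC_natr polyC_eq0.
rewrite sum_collections; apply: eq_bigr => c _; rewrite weight_last_edges.
by rewrite -mul_polyC rmorphXn rmorphN1.
Qed.

Lemma gamma_ancestral_matrix k : (k <= n)%N ->
  gamma (ancestral_matrix v) k =
  #|[set c in edge_disjoint_collections T | #|nontrivial_paths c| == k]|%:Z.
Proof.
move=> kn; rewrite /gamma char_poly_ancestral_matrix coef_sum mulr_sumr.
rewrite -sum1_card -[RHS]natz natr_sum.
rewrite [RHS](eq_bigl (fun c => (c \in edge_disjoint_collections T) &&
  (#|nontrivial_paths c| == k))) => [|c]; last by rewrite inE.
rewrite [RHS]big_mkcondr /=; apply: eq_bigr => c _.
(* Both subtrahends are at most [n], so the exponent determines the number of non-trivial paths. *)
rewrite coefZ coefXn eqn_sub2lE ?nontrivial_paths_le // mulrA -exprD eq_sym.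
case: eqP => [->|_]; last by rewrite mulr0.
by rewrite mulr1 addnn -signr_odd odd_double.
Qed.

End Collections.

Theorem theorem3p2 (T : rooted_tree) (n : nat) (v : n.-tuple T)
    (v_uniq : uniq v) (v_leaves : forall x : T, (x \in v) = is_leaf x) :
  let C := ancestral_matrix v in
  [/\ char_poly C = \sum_(k < n.+1) ((-1) ^+ k * gamma C k) *: 'X^(n - k),
      forall k : nat, (k <= n)%N ->
        gamma C k =
          #|[set c in edge_disjoint_collections T | #|nontrivial_paths c| == k]|%:Z,
      \det (1%:M + C) = (-1) ^+ n * (char_poly C).[-1],
      (-1) ^+ n * (char_poly C).[-1] = \sum_(k < n.+1) gamma C k
    & \sum_(k < n.+1) gamma C k = #|edge_disjoint_collections T|%:Z].
Proof.
move=> C.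
have charE : char_poly C = \sum_(k < n.+1) ((-1) ^+ k * gamma C k) *: 'X^(n - k).
  rewrite -[LHS]coefK size_char_poly poly_def (reindex_inj rev_ord_inj) /=.
  apply: eq_bigr => k _.
  by rewrite subSS /gamma mulrA -exprD addnn -signr_odd odd_double mul1r.
have gammaE := @gamma_ancestral_matrix T n v v_uniq v_leaves.
split=> //.
(* Evaluation at -1 commutes with the determinant and turns [X - C] into [-(1 + C)]. *)
- have -> : (char_poly C).[-1] = \det ((-1) *: (1%:M + C)).
    rewrite -[LHS]/(horner_eval (-1) (char_poly C)) /char_poly -det_map_mx.
    congr (\det _); apply/matrixP => i j; rewrite !mxE /= /horner_eval.
    by rewrite hornerD hornerN hornerMn hornerX hornerC mulN1r opprD mulNrn.
  by rewrite detZ mulrA -exprD addnn -signr_odd odd_double mul1r.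
- rewrite {1}charE horner_sum mulr_sumr; apply: eq_bigr => k _.
  rewrite hornerZ hornerXn [_ * gamma C k * _]mulrAC !mulrA -!exprD -addnA.
  have kn : (k <= n)%N by rewrite -ltnS.
  by rewrite subnK // addnAC addnn exprD -signr_odd odd_double mul1r.
rewrite (eq_bigr _ (fun (k : 'I_n.+1) _ => gammaE k (ltn_ord k))).
have nt_lt (c : path_family T) : (#|nontrivial_paths c| < n.+1)%N.
  exact: (nontrivial_paths_le v_uniq v_leaves).
rewrite -[RHS]natz -sum1_card.
(* Collections are sorted by their number of non-trivial paths. *)
rewrite (partition_big (fun c => Ordinal (nt_lt c)) predT) //=.
rewrite natr_sum; apply: eq_bigr => k _; rewrite natz; congr (Posz _).
by rewrite -[LHS]sum1_card; apply: eq_bigl => c; rewrite inE.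
Qed.
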